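(* Let $P=(X,\prec)$ be an interval order with $X=\{1,\dots,n\}$. Then the length polyhedron $Q_P\subset\mathbb{R}^n$ of $P$ is an affine cone with its apex at the length vector $\boldsymbol{\rho^*}=(r_1^*-\ell_1^*,\dots,r_n^*-\ell_n^* )$ of the canonical representation $\{[\ell_x^*,r_x^*]:x\in X\}$ of $P$.
   Context: A finite (strictly) partially ordered set $P=(X,\prec)$ is an interval order if there are compact real intervals $I_x=[\ell_x,r_x]$, $x\in X$, with $\ell_x\le r_x$, such that $x\prec y$ if and only if $r_x<\ell_y$. Throughout, an interval representation of $P$ is moreover required to satisfy $r_x+1\le \ell_y$ for all $x\prec y$. A natural representation is one in which all endpoints are non-negative integers. The magnitude $m$ of $P$ is the number of distinct down-sets $D(z)=\{x\in X: x\prec z\}$, $z\in X$ (equal to the number of distinct up-sets). The canonical representation of $P$ is the (unique) natural representation whose set of interval endpoints is $\{0,1,\dots,m-1\}$. The length polyhedron $Q_P\subset \mathbb{R}^n$ is the set of all vectors $(\rho_1,\dots,\rho_n)$ for which there is an interval representation $\{[\ell_x,r_x]\}_{x\in X}$ of $P$ with real endpoints (satisfying $r_x+1\le\ell_y$ for all $x\prec y$) such that $\rho_x=r_x-\ell_x$ for all $x\in X$. An affine cone with apex $a$ is a set of the form $a+K$, where $K$ is a pointed polyhedral cone (with its vertex at the origin); the apex is the vertex of the pointed cone. *)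

(* Defs.v *)
From mathcomp Require Import classical_sets reals.
From mathcomp Require Import all_boot all_order all_algebra.

Set Implicit Arguments.
Unset Strict Implicit.
Unset Printing Implicit Defensive.
Import Order.TTheory GRing.Theory Num.Theory.
Local Open Scope ring_scope.

(* The ground set {1, ..., n} is ['I_n], and [prec x y] is x ≺ y. *)

Definition strict_order (n : nat) (prec : rel 'I_n) : Prop :=
  irreflexive prec /\ transitive prec.

Definition interval_order (R : realType) (n : nat) (prec : rel 'I_n) : Prop :=
  strict_order prec /\
  exists l r : 'I_n -> R,
    (forall x, l x <= r x) /\ (forall x y, prec x y = (r x < l y)).

(* The unit gap [r x + 1 <= l y] is part of every representation, in contrast
   with the intervals that witness [interval_order]. *)
Definition interval_representation (R : realType) (n : nat) (prec : rel 'I_n)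
    (l r : 'I_n -> R) : Prop :=
  [/\ forall x, l x <= r x,
      forall x y, prec x y = (r x < l y)
    & forall x y, prec x y -> r x + 1 <= l y].

Definition natural_representation (R : realType) (n : nat) (prec : rel 'I_n)
    (l r : 'I_n -> nat) : Prop :=
  @interval_representation R n prec (fun x => (l x)%:R) (fun x => (r x)%:R).

Definition downset (n : nat) (prec : rel 'I_n) (z : 'I_n) : {set 'I_n} :=
  [set x | prec x z]%SET.

Definition downsets (n : nat) (prec : rel 'I_n) : {set {set 'I_n}} :=
  [set downset prec z | z : 'I_n]%SET.

Definition magnitude (n : nat) (prec : rel 'I_n) : nat := #|downsets prec|.

Definition canonical_representation (R : realType) (n : nat) (prec : rel 'I_n)
    (l r : 'I_n -> nat) : Prop :=
  natural_representation R prec l r /\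
  forall k : nat, (exists x, k = l x \/ k = r x) <-> (k < magnitude prec)%N.

Definition length_vector (R : realType) (n : nat) (l r : 'I_n -> R) :
    'cV[R]_n :=
  \col_x (r x - l x).

Definition length_polyhedron (R : realType) (n : nat) (prec : rel 'I_n) :
    set 'cV[R]_n :=
  [set rho | exists l r : 'I_n -> R,
     interval_representation prec l r /\ rho = length_vector l r]%classic.

Arguments length_polyhedron R {n} prec.

Definition polyhedral_cone (R : realType) (n : nat) (K : set 'cV[R]_n) : Prop :=
  exists (k : nat) (A : 'M[R]_(k, n)),
    K = [set v | forall i, 0 <= (A *m v) i 0]%classic.

Definition pointed (R : realType) (n : nat) (K : set 'cV[R]_n) : Prop :=
  forall v, K v -> K (- v) -> v = 0.

Definition affine_cone_with_apex (R : realType) (n : nat) (S : set 'cV[R]_n)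
    (a : 'cV[R]_n) : Prop :=
  exists K : set 'cV[R]_n,
    [/\ polyhedral_cone K, pointed K & S = [set a + v | v in K]%classic].

(* The remaining lemmas justify speaking of "the" canonical representation:
   the left endpoint of x is the rank of D(x) in the chain of down-sets, and
   its right endpoint is the rank of the largest down-set that misses x. *)

Lemma natural_representationP (R : realType) (n : nat) (prec : rel 'I_n)
    (l r : 'I_n -> nat) :
  natural_representation R prec l r <->
  (forall x, (l x <= r x)%N) /\ (forall x y, prec x y = (r x < l y)%N).
Proof.
split=> [[h1 h2 _]|[h1 h2]].
  by split=> [x|x y]; [rewrite -(ler_nat R) h1 | rewrite h2 ltr_nat].
split=> [x|x y|x y]; rewrite ?ler_nat ?ltr_nat ?h1 ?h2 //.
by move=> h; rewrite natr1 ler_nat.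
Qed.

Definition rank_left (n : nat) (prec : rel 'I_n) (x : 'I_n) : nat :=
  #|[set A in downsets prec | A \proper downset prec x]%SET|.

Definition rank_right (n : nat) (prec : rel 'I_n) (x : 'I_n) : nat :=
  #|[set A in downsets prec | x \notin A]%SET|.-1.

Lemma downset_in (n : nat) (prec : rel 'I_n) (x : 'I_n) :
  downset prec x \in downsets prec.
Proof. exact: imset_f. Qed.

Lemma downsets_chain (R : realType) (n : nat) (prec : rel 'I_n) :
  interval_order R prec ->
  forall A B, A \in downsets prec -> B \in downsets prec ->
  (A \subset B) || (B \proper A).
Proof.
move=> [_ [l [r [_ h]]]] A B /imsetP[a _ ->] /imsetP[b _ ->].
have mono u v : l u <= l v -> downset prec u \subset downset prec v.
  by move=> le; apply/subsetP=> z; rewrite !inE !h => /lt_le_trans; apply.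
rewrite properE; have [/mono ->//|/ltW /mono ->] := leP (l a) (l b).
by rewrite andTb orbN.
Qed.

Lemma canonical_representation_exists (R : realType) (n : nat)
    (prec : rel 'I_n) :
  interval_order R prec ->
  canonical_representation R prec (rank_left prec) (rank_right prec).
Proof.
move=> ioP; have chain := downsets_chain ioP.
have irr : irreflexive prec by case: ioP => [[]].
pose miss x := [set A in downsets prec | x \notin A]%SET.
have miss_gt0 x : (0 < #|miss x|)%N.
  apply/card_gt0P; exists (downset prec x).
  by rewrite !inE downset_in irr.
have cmp x y : prec x y = (rank_right prec x < rank_left prec y)%N.
  rewrite /rank_right -/(miss x) -ltnS prednK // ltnS; apply/idP/idP => [xy|].
    apply/subset_leq_card/subsetP=> A; rewrite !inE => /andP[SA xA].
    rewrite SA /=; case/orP: (chain _ _ (downset_in prec y) SA) => // /subsetP.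
    by move/(_ x); rewrite inE (negbTE xA) => /(_ xy).
  apply: contraTT => nxy; rewrite -ltnNge; apply: proper_card.
  rewrite properE; apply/andP; split.
    apply/subsetP=> A; rewrite !inE => /andP[-> /proper_sub/subsetP/(_ x)].
    by rewrite inE (negbTE nxy) /= => /contra; apply.
  apply/subsetPn; exists (downset prec y); rewrite !inE ?downset_in ?nxy //.
  by rewrite properxx andbF.
have le x : (rank_left prec x <= rank_right prec x)%N.
  by rewrite leqNgt -cmp irr.
split; first exact/natural_representationP.
have rlt x : (rank_right prec x < magnitude prec)%N.
  rewrite /rank_right /magnitude (prednK (miss_gt0 x)); apply: subset_leq_card.
  by apply/subsetP=> A; rewrite inE => /andP[].
move=> k; split=> [[x [->|->]]|lt_k]; rewrite ?rlt ?(leq_ltn_trans (le x)) //.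
pose idx (A : {set 'I_n}) := #|[set B in downsets prec | B \proper A]%SET|.
have idx_lt (A B : {set _}) : A \in downsets prec -> A \proper B -> (idx A < idx B)%N.
  move=> SA AB; apply: proper_card; rewrite properE; apply/andP; split.
    apply/subsetP=> C; rewrite !inE => /andP[-> CA].
    exact: proper_trans AB.
  by apply/subsetPn; exists A; rewrite !inE ?SA ?AB // properxx andbF.
have idx_inj : {in downsets prec &, injective idx}.
  move=> A B SA SB e; case/orP: (chain A B SA SB) => [|/(idx_lt B A SB)].
    by rewrite subEproper => /orP[/eqP//|/(idx_lt A B SA)]; rewrite e ltnn.
  by rewrite e ltnn.
have us : uniq (map idx (enum (downsets prec))).
  by rewrite map_inj_in_uniq ?enum_uniq // => A B; rewrite !mem_enum; apply: idx_inj.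
have [] := uniq_min_size us (s2 := iota 0 (magnitude prec)).
- move=> i /mapP[A]; rewrite mem_enum => /imsetP[x _ ->] ->.
  by rewrite mem_iota add0n (leq_ltn_trans (le x)).
- by rewrite size_iota size_map -cardE.
move=> _ /(_ k); rewrite mem_iota add0n lt_k => /mapP[A].
by rewrite mem_enum => /imsetP[x _ ->] ->; exists x; left.
Qed.

Lemma canonical_representation_unique (R : realType) (n : nat)
    (prec : rel 'I_n) (l r : 'I_n -> nat) :
  canonical_representation R prec l r ->
  l =1 rank_left prec /\ r =1 rank_right prec.
Proof.
case=> /natural_representationP[le cmp] ends.
pose m := magnitude prec.
pose level (k : 'I_m) : {set 'I_n} := [set x | (r x < k)%N]%SET.
have llt x : (l x < m)%N by apply/ends; exists x; left.
have rlt x : (r x < m)%N by apply/ends; exists x; right.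
have levelE y : downset prec y = level (Ordinal (llt y)).
  by apply/setP=> x; rewrite !inE cmp.
have sub : downsets prec \subset (level @: [set: 'I_m])%SET.
  by apply/subsetP=> A /imsetP[y _ ->]; rewrite levelE imset_f.
have card_im : #|(level @: [set: 'I_m])%SET| = m.
  apply/eqP; rewrite eqn_leq; apply/andP; split.
    by rewrite (leq_trans (leq_imset_card _ _)) // cardsT card_ord.
  exact: subset_leq_card sub.
have DE : downsets prec = (level @: [set: 'I_m])%SET.
  by apply/eqP; rewrite eqEcard sub card_im /=.
have inj : injective level.
  have /imset_injP h : #|(level @: [set: 'I_m])%SET| == #|[set: 'I_m]%SET|.
    by rewrite card_im cardsT card_ord.
  by move=> i j; apply: h; rewrite inE.
have mono (i j : 'I_m) : (i <= j)%N -> level i \subset level j.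
  by move=> ij; apply/subsetP=> x; rewrite !inE => /leq_trans; apply.
have properE' i j : (level i \proper level j) = (i < j)%N.
  apply/idP/idP=> [|ij].
    by apply: contraTT; rewrite -leqNgt properE => /mono ->; rewrite andbF.
  rewrite properEneq mono 1?ltnW // andbT; apply/eqP=> /inj e.
  by rewrite e ltnn in ij.
have card_lt a : (a <= m)%N -> #|[set k : 'I_m | (k < a)%N]%SET| = a.
  move=> am; rewrite -[RHS]card_ord -cardsT.
  have winj : injective (widen_ord am) by move=> i j [/val_inj].
  rewrite -(card_imset _ winj).
  apply: eq_card => k; rewrite !inE; apply/idP/imsetP=> [ka|[j _ ->] /=].
    by exists (Ordinal ka) => //; apply: val_inj.
  exact: ltn_ord.
split=> x.
  rewrite /rank_left -[LHS](card_lt _ (ltnW (llt x))) -(card_imset _ inj).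
  apply: eq_card => A; rewrite inE DE levelE; apply/imsetP/andP.
    by case=> k; rewrite inE => kl ->; rewrite imset_f // properE'.
  by case=> /imsetP[k _ ->]; rewrite properE' => kl; exists k; rewrite ?inE.
rewrite /rank_right -[LHS]/((r x).+1.-1) -[(r x).+1](card_lt _ (rlt x)).
rewrite -(card_imset _ inj); congr _.-1; apply: eq_card => A.
rewrite inE DE; apply/imsetP/andP.
  by case=> k; rewrite inE ltnS => kr ->; rewrite imset_f // inE -leqNgt.
by case=> /imsetP[k _ ->]; rewrite inE -leqNgt => kr; exists k; rewrite ?inE.
Qed.

(* Main.v *)
Require Import Defs.
From mathcomp Require Import classical_sets reals.
From mathcomp Require Import all_boot all_order all_algebra.
From mathcomp Require Import lra.
Import Order.TTheory GRing.Theory Num.Theory.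
Local Open Scope ring_scope.

(** Write [l], [r] for the endpoints of the canonical representation, and let
    [K] be the set of the vectors [v = e - d] for which moving each left
    endpoint [l x] by [d x] and each right endpoint [r x] by [e x] widens, or
    leaves unchanged, every gap [l y - r x] (for x ≺ y) and every overlap
    [r x - l y] (otherwise).  The claim is that the length polyhedron is
    [rho* + K], where [rho*] is the vector of the canonical lengths [r x - l x].

    Moving the canonical endpoints by such [d] and [e] clearly gives a
    representation.  Conversely, let [d] and [e] be the differences between
    the endpoints of any representation and the canonical ones.  A canonical
    gap equal to 1 and a canonical overlap equal to 0 are the smallest that a
    representation allows, so neither is smaller in the given representation:
    [e x <= d y] if [l y = r x + 1], and [d y <= e x] if [l y = r x].  Now each
    level 0, ..., m-1, with [m] the magnitude, is both a left and a right
    endpoint of the canonical representation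
    ([canonical_left_onto], [canonical_right_onto]), so these
    inequalities chain through consecutive levels and give the ones required
    for all gaps and overlaps ([level_chain]).

    The set [K] is the projection along [d] of a polyhedral cone, hence
    polyhedral by Fourier-Motzkin elimination ([polyhedral_cone_proj]).
    It lies in the non-negative orthant, because the length of an interval is
    the overlap of the interval with itself; so it is pointed. *)

(** * Fourier-Motzkin elimination *)

(** Finite sets of lower and of upper bounds, possibly empty, are separated by
    a number as soon as no lower bound exceeds an upper bound. *)
Lemma finite_separation (R : realFieldType) (I : finType) (P Q : pred I)
    (lo hi : I -> R) :
  (forall p q, P p -> Q q -> lo p <= hi q) ->
  exists t, (forall p, P p -> lo p <= t) /\ (forall q, Q q -> t <= hi q).
Proof.
move=> lohi; case: (pickP P) => [p0 Pp0|P0].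
  case: (arg_maxP lo Pp0) => p Pp maxp.
  by exists (lo p); split=> [p' /maxp //|q]; apply: lohi.
case: (pickP Q) => [q0 Qq0|Q0].
  case: (arg_minP hi Qq0) => q Qq minq.
  by exists (hi q); split=> [p|q' /minq //]; rewrite P0.
by exists 0; split=> i; rewrite ?P0 ?Q0.
Qed.

Lemma polyhedral_cone_fin (R : realType) (n : nat) (I : finType)
    (f : I -> 'rV[R]_n) :
  polyhedral_cone [set v : 'cV[R]_n | forall i, 0 <= (f i *m v) 0 0]%classic.
Proof.
exists #|I|, (\matrix_i f (enum_val i)).
have E v i : ((\matrix_i f (enum_val i)) *m v) i 0 = (f (enum_val i) *m v) 0 0.
  by rewrite !mxE; apply: eq_bigr => j _; rewrite mxE.
apply/seteqP; split=> v /= h i; first by rewrite E.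
by have := h (enum_rank i); rewrite E enum_rankK.
Qed.

(** The system [0 <= a i * t + b i] eliminates [t]: the inequalities without
    [t] remain, and those with opposite signs of the coefficient of [t] are
    combined in pairs. *)
Lemma Fourier_Motzkin (R : realFieldType) (I : finType) (a b : I -> R) :
  (exists t, forall i, 0 <= a i * t + b i) <->
  (forall i, a i = 0 -> 0 <= b i) /\
  (forall p q, 0 < a p -> a q < 0 -> 0 <= a p * b q - a q * b p).
Proof.
split=> [[t h]|[h0 hpq]].
  split=> [i ai0|p q ap aq]; first by have := h i; rewrite ai0 mul0r add0r.
  have := addr_ge0 (mulr_ge0 (ltW ap) (h q))
                   (mulr_ge0 (ltW (_ : 0 < - a q)) (h p)).
  by rewrite oppr_gt0 => /(_ aq); congr (0 <= _); lra.
have [|t [tp tq]] := @finite_separation R I (fun p => 0 < a p)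
    (fun q => a q < 0) (fun p => - b p / a p) (fun q => - b q / a q).
  move=> p q ap aq; rewrite ler_pdivrMr // mulrAC ler_ndivlMr //.
  by have := hpq p q ap aq; lra.
exists t => i; have [ai|ai|ai] := ltgtP (a i) 0.
- by have := tq i ai; rewrite ler_ndivlMr // => ?; lra.
- by have := tp i ai; rewrite ler_pdivrMr // => ?; lra.
- by rewrite ai mul0r add0r h0.
Qed.

Lemma polyhedral_cone_proj1 (R : realType) (n : nat)
    (K : set 'cV[R]_(1 + n)) :
  polyhedral_cone K ->
  polyhedral_cone
    [set v : 'cV[R]_n | exists t : 'cV[R]_1, K (col_mx t v)]%classic.
Proof.
case=> k [A ->].
pose a i : R := A i (lshift n 0); pose B := rsubmx A.
have E (t : 'cV_1) (v : 'cV[R]_n) i :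
    (A *m col_mx t v) i 0 = a i * t 0 0 + (B *m v) i 0.
  rewrite -[A]hsubmxK mul_row_col mxE; congr (_ + _).
  by rewrite mxE big_ord1 mxE.
pose f (pq : 'I_k * 'I_k) : 'rV[R]_n :=
  if a pq.1 == 0 then row pq.1 B
  else if (0 < a pq.1) && (a pq.2 < 0)
       then a pq.1 *: row pq.2 B - a pq.2 *: row pq.1 B else 0.
have rowE p (v : 'cV[R]_n) : (row p B *m v) 0 0 = (B *m v) p 0.
  by rewrite -row_mul mxE.
rewrite [X in polyhedral_cone X](_ : _ =
  [set v | forall pq, 0 <= (f pq *m v) 0 0]%classic);
  first exact: polyhedral_cone_fin.
have FM (v : 'cV[R]_n) := @Fourier_Motzkin R _ a (fun i => (B *m v) i 0).
have combE p q (v : 'cV[R]_n) : ((a p *: row q B - a q *: row p B) *m v) 0 0 =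
    a p * (B *m v) q 0 - a q * (B *m v) p 0.
  by rewrite mulmxBl -!scalemxAl 2!mxE [X in _ + X]mxE [X in _ - X]mxE !rowE.
apply/seteqP; split=> v /=.
  case=> t ht; have [|h0 hpq] := (FM v).1.
    by exists (t 0 0) => i; rewrite -E.
  case=> p q; rewrite /f /=; case: eqP => [/h0|_]; first by rewrite rowE.
  case: ifP => [/andP[ap aq]|_]; last by rewrite mul0mx mxE.
  by rewrite combE hpq.
move=> h; have [|t ht] := (FM v).2; last first.
  by exists t%:M => i; rewrite E mxE eqxx mulr1n.
split=> [i ai|p q ap aq].
  by have := h (i, i); rewrite /f /= ai eqxx rowE.
by have := h (p, q); rewrite /f /= gt_eqF // ap aq combE.
Qed.

Lemma polyhedral_cone_proj (R : realType) (m n : nat) (K : set 'cV[R]_(m + n)) :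
  polyhedral_cone K ->
  polyhedral_cone
    [set v : 'cV[R]_n | exists d : 'cV[R]_m, K (col_mx d v)]%classic.
Proof.
elim: m K => [|m IH] K polK.
  rewrite [X in polyhedral_cone X](_ : _ = K) //.
  have E (d : 'cV[R]_0) (v : 'cV[R]_n) : col_mx d v = v.
    apply/matrixP=> i j; rewrite mxE; case: splitP => [[]//|i' /= ii'].
    by congr (v _ _); apply: val_inj.
  by apply/seteqP; split=> v /= => [[d]|Kv]; [rewrite E | exists 0; rewrite E].
have := IH _ (@polyhedral_cone_proj1 R (m + n) K polK).
congr (polyhedral_cone _); apply/seteqP.
have E (t : 'cV[R]_1) (d : 'cV[R]_m) (v : 'cV[R]_n) :
    col_mx t (col_mx d v) = col_mx (col_mx t d : 'cV_m.+1) v.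
  by rewrite col_mxA castmx_id.
split=> v /=.
  by move=> [d [t Kdt]]; exists (col_mx t d); rewrite -E.
move=> [d]; rewrite -[d](@vsubmxK _ 1 m) -E => Kd.
by exists (@dsubmx _ 1 m _ d), (@usubmx _ 1 m _ d).
Qed.

(** * The cone of length changes *)

(** The length changes [v] that come from moving left endpoints by [d] and
    right endpoints by [d + v] in such a way that no gap between comparable
    elements and no overlap between the others shrinks. *)
Definition widening_cone (R : realType) (n : nat) (prec : rel 'I_n) :
    set 'cV[R]_n :=
  [set v | exists d : 'cV[R]_n, forall x y,
     if prec x y then d x 0 + v x 0 <= d y 0
     else d y 0 <= d x 0 + v x 0]%classic.

Lemma widening_cone_polyhedral (R : realType) (n : nat) (prec : rel 'I_n) :
  polyhedral_cone (widening_cone R n prec).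
Proof.
pose s (xy : 'I_n * 'I_n) : R := if prec xy.1 xy.2 then -1 else 1.
pose f (xy : 'I_n * 'I_n) : 'rV[R]_(n + n) :=
  s xy *: (row_mx (delta_mx 0 xy.1 - delta_mx 0 xy.2) (delta_mx 0 xy.1)).
have E xy d v :
    (f xy *m col_mx d v) 0 0 = s xy * (d xy.1 0 + v xy.1 0 - d xy.2 0).
  by rewrite -scalemxAl mul_row_col mulmxBl -!rowE !mxE addrAC.
have := @polyhedral_cone_proj R n n _ (@polyhedral_cone_fin R (n + n) _ f).
congr (polyhedral_cone _); apply/seteqP; split=> v /= [d h]; exists d.
  move=> x y; have := h (x, y); rewrite E /s /=.
  by case: ifP => _ ?; lra.
move=> [x y]; rewrite E /s /=; have := h x y.
by case: ifP => _ ?; lra.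
Qed.

Lemma widening_cone_pointed (R : realType) (n : nat) (prec : rel 'I_n) :
  irreflexive prec -> pointed (widening_cone R n prec).
Proof.
move=> irr; have ge0 v : widening_cone R n prec v -> forall x, 0 <= v x 0.
  by case=> d h x; have := h x x; rewrite irr lerDl.
move=> v /ge0 v0 /ge0 Nv0; apply/colP => x; rewrite mxE.
apply/eqP; rewrite eq_le v0 andbT.
by have := Nv0 x; rewrite mxE oppr_ge0.
Qed.

(** * Levels of the canonical representation *)

(** The down-set of [y] depends only on [l y], and there are as many down-sets
    as levels; so all levels occur as left endpoints, and distinct levels have
    distinct down-sets. *)
Lemma canonical_left_onto_inj (R : realType) (n : nat) (prec : rel 'I_n)
    (l r : 'I_n -> nat) :
  canonical_representation R prec l r ->
  (forall k, (k < magnitude prec)%N -> exists y, l y = k) /\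
  (forall y z, downset prec y = downset prec z -> l y = l z).
Proof.
case=> /natural_representationP[_ cmp] ends.
have llt x : (l x < magnitude prec)%N by apply/ends; exists x; left.
pose lev x := Ordinal (llt x).
pose D (k : 'I_(magnitude prec)) : {set 'I_n} := [set x | (r x < k)%N]%SET.
pose L := (lev @: [set: 'I_n])%SET.
have DE y : downset prec y = D (lev y) by apply/setP=> x; rewrite !inE cmp.
have imD : downsets prec = (D @: L)%SET.
  rewrite /L -imset_comp.
  apply/setP=> A; apply/imsetP/imsetP=> -[y _ ->]; exists y;
    by rewrite ?inE //= DE.
have cardL : #|L| = magnitude prec.
  apply: anti_leq; apply/andP; split.
    by apply: leq_trans (max_card _) _; rewrite card_ord.
  by have := leq_imset_card D (mem L); rewrite -imD.
split=> [k km|y z].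
  have /imsetP[y _ /(congr1 val) /= ->] : Ordinal km \in L; last by exists y.
  suff -> : L = [set: _]%SET by rewrite inE.
  by apply/eqP; rewrite eqEcard subsetT cardsT card_ord cardL /=.
have /imset_injP injD : #|(D @: L)%SET| == #|L| by rewrite -imD cardL.
rewrite !DE => /injD e.
by apply: (congr1 val (e _ _)); rewrite imset_f ?inE.
Qed.

Lemma canonical_left_onto (R : realType) (n : nat) (prec : rel 'I_n)
    (l r : 'I_n -> nat) (k : nat) :
  canonical_representation R prec l r ->
  (k < magnitude prec)%N -> exists y, l y = k.
Proof. by case/canonical_left_onto_inj=> + _; apply. Qed.

(** A level [k] that is not a right endpoint could be merged with [k + 1]: the
    down-sets [r x < k] and [r x < k + 1] would coincide. *)
Lemma canonical_right_onto (R : realType) (n : nat) (prec : rel 'I_n)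
    (l r : 'I_n -> nat) (k : nat) :
  canonical_representation R prec l r ->
  (k < magnitude prec)%N -> exists x, r x = k.
Proof.
move=> hcan km; have [onto inj] := canonical_left_onto_inj _ _ _ _ _ hcan.
case: (hcan) => /natural_representationP[le cmp] ends.
have [y ly] := onto k km.
have [km1|mk1] := ltnP k.+1 (magnitude prec); last first.
  (* at the top level, an interval that starts there also ends there *)
  have rm : (r y < magnitude prec)%N by apply/ends; exists y; right.
  by exists y; apply/eqP; rewrite eqn_leq -{2}ly le -ltnS (leq_trans rm mk1).
have [z lz] := onto k.+1 km1.
have [x /eqP rx|no] := pickP (fun x => r x == k); first by exists x.
have /inj : downset prec y = downset prec z; last first.
  by rewrite ly lz => /eqP; rewrite ltn_eqF.
by apply/setP=> x; rewrite !inE !cmp ly lz ltnS [RHS]leq_eqVlt no.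
Qed.

(** If [d] on the left endpoints and [e] on the right endpoints increase
    weakly along each step of the order left 0, right 0, left 1, right 1, ...,
    then they increase along the whole order. *)
Lemma level_chain (R : realType) (n : nat) (prec : rel 'I_n)
    (l r : 'I_n -> nat) (d e : 'I_n -> R) :
  canonical_representation R prec l r ->
  (forall x y, l y = r x -> d y <= e x) ->
  (forall x y, l y = (r x).+1 -> e x <= d y) ->
  forall x y, if prec x y then e x <= d y else d y <= e x.
Proof.
move=> hcan de ed.
case: (hcan) => /natural_representationP[_ cmp] ends.
have rlt x : (r x < magnitude prec)%N by apply/ends; exists x; right.
have llt x : (l x < magnitude prec)%N by apply/ends; exists x; left.
have lft k := @canonical_left_onto R n prec l r k hcan.
have rgt k := @canonical_right_onto R n prec l r k hcan.
have up j : forall x y, r x = (l y + j)%N -> d y <= e x.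
  elim: j => [|j IH] x y rx; first by apply: de; rewrite rx addn0.
  have [x' rx'] := rgt _ (llt y).
  have [|y' ly'] := lft (l y).+1.
    by apply: leq_ltn_trans (rlt x); rewrite rx addnS ltnS leq_addr.
  apply: le_trans (de x' y _) (le_trans (ed x' y' _) (IH x y' _)) => //.
    by rewrite ly' rx'.
  by rewrite rx ly' addnS.
move=> x y; rewrite cmp; case: ltnP => [rl|lr]; last first.
  by apply: (up (r x - l y)%N); rewrite subnKC.
have rm : ((r x).+1 < magnitude prec)%N := leq_ltn_trans rl (llt y).
move: rl; rewrite leq_eqVlt => /orP[/eqP rl|rl]; first exact: ed.
(* pass through the element whose right endpoint is just below [l y] *)
have ly0 : l y = (l y).-1.+1 by rewrite (ltn_predK rl).
have [|x' rx'] := rgt (l y).-1; first by rewrite -ly0 ltnW.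
have [y' ly'] := lft _ rm.
apply: le_trans (ed x y' ly') (le_trans (up (r x' - l y')%N x' y' _) _).
  by rewrite subnKC // ly' rx' -ltnS -ly0.
by apply: ed; rewrite rx'.
Qed.

Theorem theorem5p1 (R : realType) (n : nat) (prec : rel 'I_n)
    (l r : 'I_n -> nat)
    (hP : interval_order R prec)
    (hcan : canonical_representation R prec l r) :
  affine_cone_with_apex (length_polyhedron R prec)
    (length_vector (fun x => (l x)%:R : R) (fun x => (r x)%:R : R)).
Proof.
have [[irr _] _] := hP.
exists (widening_cone R n prec); split.
- exact: widening_cone_polyhedral.
- exact: widening_cone_pointed.
have [[le cmp gap] _] := hcan.
apply/seteqP; split=> rho /=.
  move=> [l' [r' [[le' cmp' gap'] ->]]].
  exists (length_vector l' r' -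
          length_vector (fun x => (l x)%:R : R) (fun x => (r x)%:R : R));
    last by rewrite addrC subrK.
  pose d x : R := l' x - (l x)%:R; pose e x : R := r' x - (r x)%:R.
  exists (\col_x d x) => x y.
  have := @level_chain R n prec l r d e hcan.
  have de x0 y0 : l y0 = r x0 -> d y0 <= e x0.
    move=> lr; by rewrite /d /e lr lerD2r leNgt -cmp' cmp lr ltxx.
  have ed x0 y0 : l y0 = (r x0).+1 -> e x0 <= d y0.
    move=> lr; have : prec x0 y0 by rewrite cmp lr ltr_nat.
    by move/gap'; rewrite /d /e lr -natr1 => ?; lra.
  move=> /(_ de ed x y); rewrite !mxE /d /e.
  by case: ifP => _ ?; lra.
move=> [v [d h] <-].
exists (fun x => (l x)%:R + d x 0), (fun x => (r x)%:R + (d x 0 + v x 0)).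
split; last by apply/colP=> x; rewrite !mxE; lra.
split=> [x|x y|x y xy].
- by apply: lerD => //; have := h x x; rewrite irr.
- apply/idP/idP=> [xy|].
    by have := h x y; have := gap x y xy; rewrite xy => ? ?; lra.
  apply: contraTT => nxy; rewrite -leNgt; apply: lerD.
    by rewrite leNgt -cmp.
  by have := h x y; rewrite (negbTE nxy).
- by have := h x y; have := gap x y xy; rewrite xy => ? ?; lra.
Qed.
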